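(* Let $X$ be a simple connected unweighted graph. The following statements hold. 1. If $X$ is regular, then two vertices in $X$ are strongly cospectral with respect to $M(X)$ if and only if they are strongly cospectral with respect to $M(\overline{X})$. 2. If $\beta=-\gamma$, then two vertices in $X$ are strongly cospectral with respect to $\mathbf{A}(X)$ if and only if they are strongly cospectral with respect to $\mathbf{A}(\overline{X})$.
   Context: Graphs are finite; simple unweighted means no loops, no multiple edges and all edge weights one. $\overline{X}$ is the complement of $X$. $A(X)$ is the adjacency matrix and $D(X)$ the diagonal matrix of vertex degrees. Fix real $\alpha,\beta,\gamma$ with $\gamma\neq0$ (the same for $X$ and $\overline{X}$). The generalized adjacency matrix is $\mathbf{A}(X)=\alpha I+\beta D(X)+\gamma A(X)$; if all degrees are positive, the generalized normalized adjacency matrix is $\mathcal{A}(X)=\alpha I+\gamma D(X)^{-1/2}A(X)D(X)^{-1/2}$. $M$ denotes either $\mathbf{A}$ or (when defined) $\mathcal{A}$, with the same choice for $X$ and $\overline{X}$. For a real symmetric matrix $N=\sum_j\lambda_jE_j$ (spectral decomposition with distinct eigenvalues $\lambda_j$ and orthogonal projections $E_j$ onto the eigenspaces), $u$ and $v$ are strongly cospectral with respect to $N$ if for each $j$, $E_j\mathbf{e}_u=E_j\mathbf{e}_v$ or $E_j\mathbf{e}_u=-E_j\mathbf{e}_v$, where $\mathbf{e}_u$ is the characteristic vector of $u$.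
   Formalization: The graph on two vertices (X = K_2) is excluded: its two vertices are strongly cospectral with respect to A(X), but not with respect to A of the edgeless complement, which is αI, so both parts fail for it. *)

(* Defs.v *)
From HB Require Import structures.
From mathcomp Require Import all_boot all_order all_algebra.
From mathcomp Require Import reals.

Set Implicit Arguments.
Unset Strict Implicit.
Unset Printing Implicit Defensive.

Import Order.TTheory GRing.Theory Num.Theory.
Local Open Scope ring_scope.

Record sgraph (n : nat) := SGraph {
  adj : rel 'I_n;
  adj_sym : symmetric adj;
  adj_irr : irreflexive adj }.

Section Graph.
Context {n : nat} (X : sgraph n).

Definition gconnected : Prop := forall u v : 'I_n, connect (adj X) u v.

Definition deg (u : 'I_n) : nat := #|[set v | adj X u v]|.

Definition regular : Prop := exists k : nat, forall u, deg u = k.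

Definition degs_pos : Prop := forall u, (0 < deg u)%N.

Definition compl_adj : rel 'I_n := fun u v => (u != v) && ~~ adj X u v.

Lemma compl_adj_sym : symmetric compl_adj.
Proof. by move=> u v; rewrite /compl_adj eq_sym adj_sym. Qed.

Lemma compl_adj_irr : irreflexive compl_adj.
Proof. by move=> u; rewrite /compl_adj eqxx. Qed.

Definition gcompl : sgraph n := SGraph compl_adj_sym compl_adj_irr.

End Graph.

Section Matrices.
Context {R : rcfType} {n : nat}.
Implicit Types (X : sgraph n) (alpha beta gamma : R).

Definition adjmx X : 'M[R]_n := \matrix_(u, v) (adj X u v)%:R.

Definition degmx X : 'M[R]_n := diag_mx (\row_u (deg X u)%:R).

(* D(X)^(-1/2); only meaningful under [degs_pos X], since 0^-1 = 0. *)
Definition degmx_isqrt X : 'M[R]_n :=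
  diag_mx (\row_u (Num.sqrt (deg X u)%:R)^-1).

Definition gen_adjmx alpha beta gamma X : 'M[R]_n :=
  alpha%:M + beta *: degmx X + gamma *: adjmx X.

Definition gen_norm_adjmx alpha gamma X : 'M[R]_n :=
  alpha%:M + gamma *: (degmx_isqrt X *m adjmx X *m degmx_isqrt X).

(* Orthogonal projection onto the row space of U, acting on row vectors from
   the right: kermx U^T spans the orthogonal complement of that row space.
   This is [proj_ortho] of spectral.v, which requires a numClosedFieldType. *)
Definition orthproj (U : 'M[R]_n) : 'M[R]_n := proj_mx U (kermx U^T).

Definition charvec (u : 'I_n) : 'rV[R]_n := delta_mx 0 u.

(* Intended for symmetric N, for which row and column eigenvectors are
   transposes of each other; all the eigenvalues of such an N lie in R. *)
Definition strongly_cospectral (N : 'M[R]_n) (u v : 'I_n) : Prop :=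
  forall lambda : R, eigenvalue N lambda ->
    let E := orthproj (eigenspace N lambda) in
    charvec u *m E = charvec v *m E \/ charvec u *m E = - (charvec v *m E).

End Matrices.

(* Main.v *)
Require Import Defs.
From mathcomp Require Import all_boot all_order all_algebra.
From mathcomp Require Import reals.
From mathcomp Require Import spectral complex ring.

Set Implicit Arguments.
Unset Strict Implicit.
Unset Printing Implicit Defensive.

Import Order.TTheory GRing.Theory Num.Theory.
Local Open Scope ring_scope.

(** Write [L] and [L'] for the Laplacians [D - A] of [X] and of its complement,
    and [J] for the all-ones matrix.

    In every case of the theorem both matrices are of the form [a I + c L],
    resp. [a' I + c' L'], with [c] and [c'] nonzero: for [beta = - gamma] this
    is immediate, and on a regular graph [D] is scalar. Strong
    cospectrality only depends on the eigenspaces, so everything reduces to a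
    statement on Laplacians, [strongly_cospectral_lap_complE]. It is used in
    the following form, which avoids projections
    ([strongly_cospectralP]): on each eigenspace, either all eigenvectors agree
    at [u] and [v], or all take opposite values there.

    Since [L + L' = n I - J], and since an eigenvector of a Laplacian for a
    nonzero eigenvalue has entries summing to zero, such an eigenvector of [L]
    for [l] is one of [L'] for [n - l], and conversely. So the sign condition
    passes from one graph to the other except on the kernel, where it must be
    checked that eigenvectors take the same value at [u] and [v]. The kernel
    consists of the functions constant on connected components. As [X] is
    connected, this settles one direction. For the other one it has to be shown
    that [u] and [v] lie in one component of the complement.

    Suppose not, and let [C] be the component of [u] in the complement. If an
    eigenvector of [L'] is supported on [C] with entries summing to zero, it is
    an eigenvector of [L] vanishing at [v], hence at [u] by strong
    cospectrality. Decomposing the characteristic vector of [u] into such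
    eigenvectors and multiples of the indicator of [C] then forces
    [C = {u}] ([compl_component_card]). Finally [n 1_C - 1] is an
    eigenvector of [L] for [n], with values [n - 1] at [u] and [-1] at [v];
    these are equal up to sign only for [n = 2]. *)

(** * Spectral decomposition of real symmetric matrices *)

Lemma sum_Re (R : rcfType) (I : finType) (F : I -> R[i]) :
  complex.Re (\sum_i F i) = \sum_i complex.Re (F i).
Proof. by apply: (big_morph (@complex.Re R)) => // -[a b] [c d]. Qed.

Lemma Re_mulr (R : rcfType) (y : R[i]) (a : R) :
  complex.Re (y * (real_complex R a)) = complex.Re y * a.
Proof. by case: y => p q /=; rewrite mulr0 subr0. Qed.

(** The spectral theorem, in the form that every vector is a sum of
    eigenvectors. It is obtained from the one for Hermitian matrices over
    [R[i]]: the eigenvalues being real, the real part of an eigenvector is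
    again an eigenvector, or zero. *)
Lemma symmetric_eigen_sum (R : rcfType) (n : nat) (A : 'M[R]_n)
    (symA : A^T = A) (z : 'rV[R]_n) :
  exists (lam : 'I_n -> R) (x : 'I_n -> 'rV[R]_n),
    (forall i, x i *m A = lam i *: x i) /\ z = \sum_i x i.
Proof.
pose B : 'M[R[i]]_n := map_mx (real_complex R) A.
have hB : B \is hermsymmx.
  apply: realsym_hermsym.
    apply/is_hermitianmxP; rewrite expr0 scale1r.
    by apply/matrixP => i j; rewrite !mxE -[in LHS]symA mxE.
  by apply/mxOverP => i j; rewrite mxE complex_real.
have /orthomx_spectralP eqB := hermitian_normalmx hB.
have /mxOverP dreal := hermitian_spectral_diag_real hB.
set P := spectralmx B in eqB; set d := spectral_diag B in eqB dreal.
have Pu : P \in unitmx := spectral_unit B.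
have PB : P *m B = diag_mx d *m P by rewrite eqB !mulmxA mulmxV // mul1mx.
pose c := map_mx (real_complex R) z *m invmx P.
pose y i := c 0 i *: row i P.
have yB i : y i *m B = d 0 i *: y i.
  rewrite -scalemxAl -row_mul PB row_mul row_diag_mx -scalemxAl -rowE.
  by rewrite !scalerA mulrC.
have yz : map_mx (real_complex R) z = \sum_i y i.
  by rewrite -[LHS](mulmxKV Pu) -/c mulmx_sum_row.
exists (fun i => complex.Re (d 0 i)), (fun i => map_mx (@complex.Re R) (y i)).
split.
  move=> i; apply/rowP => j.
  transitivity (complex.Re ((y i *m B) 0 j)).
    rewrite [LHS]mxE [in RHS]mxE sum_Re; apply: eq_bigr => k _.
    by rewrite [map_mx _ A k j]mxE Re_mulr; congr (_ * _); rewrite mxE.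
  rewrite yB [in LHS]mxE [in RHS]mxE [map_mx _ _ _ _]mxE.
  by rewrite -{1}[d 0 i]RRe_real ?dreal // mulrC Re_mulr mulrC.
apply/rowP => j; have := congr1 (fun M : 'rV_n => complex.Re (M 0 j)) yz.
rewrite mxE /= summxE sum_Re => ->; rewrite summxE.
by apply: eq_bigr => i _; rewrite [RHS]mxE.
Qed.

(** * Strong cospectrality in terms of eigenvectors *)

Lemma mulmx_tr_self_eq0 (R : realDomainType) (n : nat) (x : 'rV[R]_n) :
  x *m x^T = 0 -> x = 0.
Proof.
move/matrixP/(_ 0 0); rewrite !mxE => /eqP.
under eq_bigr do rewrite mxE -expr2.
rewrite psumr_eq0 => [/allP x0|i _]; last exact: sqr_ge0.
apply/rowP => i; rewrite mxE; apply/eqP.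
by rewrite -sqrf_eq0; apply: x0; rewrite mem_index_enum.
Qed.

(** Over an ordered field [U] and [kermx U^T] are complementary, because no
    nonzero vector is orthogonal to itself; this makes [orthproj U] a genuine
    projection, with kernel the orthogonal complement of [U]. *)
Lemma orthproj_eq0 (R : rcfType) (n : nat) (U : 'M[R]_n) (w : 'rV[R]_n) :
  w *m orthproj U = 0 <-> forall x : 'rV[R]_n, (x <= U)%MS -> x *m w^T = 0.
Proof.
have capU0 : (U :&: kermx U^T)%MS = 0.
  apply/eqP/rowV0P => x; rewrite sub_capmx.
  move=> /andP[/submxP[D xDU] /sub_kermxP xU].
  by apply: mulmx_tr_self_eq0; rewrite {2}xDU trmx_mul mulmxA xU mul0mx.
have fullU : row_full (U + kermx U^T)%MS.
  rewrite /row_full mxrank_disjoint_sum // mxrank_ker mxrank_tr.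
  by rewrite subnKC ?rank_leq_row.
have kerE : (w <= kermx U^T)%MS <->
    forall x : 'rV[R]_n, (x <= U)%MS -> x *m w^T = 0.
  split=> [/sub_kermxP wU x /submxP[D ->]|Uw].
    by rewrite -mulmxA -[U]trmxK -trmx_mul wU trmx0 mulmx0.
  apply/sub_kermxP/trmx_inj; rewrite trmx_mul trmxK trmx0.
  by apply/row_matrixP => i; rewrite row_mul Uw ?row_sub // row0.
rewrite -kerE; split=> [w0|]; last exact: proj_mx_0.
have := @proj_mx_compl_sub _ _ _ U (kermx U^T) w (submx_full _ fullU).
by rewrite [w *m _]w0 subr0.
Qed.

(** The difference of the two sides is the projection of
    [charvec u - s *: charvec v], whose inner product with [x] is
    [x 0 u - s * x 0 v]. *)
Lemma charvec_orthproj (R : rcfType) (n : nat) (U : 'M[R]_n) (u v : 'I_n) (s : R) :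
  charvec u *m orthproj U = s *: (charvec v *m orthproj U) <->
  forall x : 'rV[R]_n, (x <= U)%MS -> x 0 u = s * x 0 v.
Proof.
have dotE (x : 'rV[R]_n) :
    x *m (charvec u - s *: charvec v)^T = (x 0 u - s * x 0 v)%:M.
  rewrite linearB linearZ /= mulmxBr -scalemxAr !trmx_delta -!colE.
  by apply/rowP => i; rewrite !mxE ord1 eqxx.
transitivity ((charvec u - s *: charvec v) *m orthproj U = 0).
  rewrite mulmxBl -scalemxAl; split=> [->|/eqP]; first exact: subrr.
  by rewrite subr_eq0 => /eqP.
rewrite orthproj_eq0; split=> H x /H.
  by rewrite dotE => /matrixP/(_ 0 0)/eqP; rewrite !mxE subr_eq0 => /eqP.
by move=> xuv; rewrite dotE xuv subrr raddf0.
Qed.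

Lemma strongly_cospectralP (R : rcfType) (n : nat) (N : 'M[R]_n) (u v : 'I_n) :
  strongly_cospectral N u v <->
  forall lambda : R,
    (forall x : 'rV[R]_n, x *m N = lambda *: x -> x 0 u = x 0 v) \/
    (forall x : 'rV[R]_n, x *m N = lambda *: x -> x 0 u = - x 0 v).
Proof.
split=> sc l; last first.
  move=> _ /=; case: (sc l) => Hl; [left|right].
    rewrite -[RHS]scale1r; apply/charvec_orthproj => x /eigenspaceP/Hl.
    by rewrite mul1r.
  rewrite -scaleN1r; apply/charvec_orthproj => x /eigenspaceP/Hl.
  by rewrite mulN1r.
have [/sc/= [E|E]|lN] := boolP (eigenvalue N l).
- left=> x /eigenspaceP; rewrite -[RHS]mul1r; move: x.
  by apply/charvec_orthproj; rewrite scale1r.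
- right=> x /eigenspaceP; rewrite -[RHS]mulN1r; move: x.
  by apply/charvec_orthproj; rewrite scaleN1r.
left=> x /eigenspaceP; move: lN; rewrite negbK => /eqP->.
by rewrite submx0 => /eqP->; rewrite !mxE.
Qed.

(** Both matrices have the same eigenvectors, and [l |-> a + c * l] permutes
    the scalars. *)
Lemma strongly_cospectral_affine (R : rcfType) (n : nat) (N : 'M[R]_n) (a c : R)
    (c_neq0 : c != 0) (u v : 'I_n) :
  strongly_cospectral (a%:M + c *: N) u v <-> strongly_cospectral N u v.
Proof.
have eigE (x : 'rV[R]_n) (l : R) :
    x *m (a%:M + c *: N) = (a + c * l) *: x <-> x *m N = l *: x.
  rewrite mulmxDr mul_mx_scalar -scalemxAr scalerDl -scalerA.
  by split=> [/addrI/(scalerI c_neq0)|->].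
rewrite !strongly_cospectralP; split=> sc l.
  by case: (sc (a + c * l)) => Hl; [left|right] => x /eigE/Hl.
have -> : l = a + c * ((l - a) / c) by rewrite mulrC divfK // addrC subrK.
by case: (sc ((l - a) / c)) => Hl; [left|right] => x /eigE/Hl.
Qed.

(** * The Laplacian and its kernel *)

Definition lap (R : rcfType) (n : nat) (X : sgraph n) : 'M[R]_n :=
  degmx X - adjmx X.

Lemma sum_adj (R : rcfType) (n : nat) (X : sgraph n) (u : 'I_n) :
  \sum_v (adj X u v)%:R = (deg X u)%:R :> R.
Proof.
rewrite -natr_sum -big_mkcond /= sum1_card; congr (_%:R).
by apply: eq_card => v; rewrite !inE.
Qed.

Lemma lap_act (R : rcfType) (n : nat) (X : sgraph n) (x : 'rV[R]_n) (w : 'I_n) :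
  (x *m lap R X) 0 w = \sum_v (adj X w v)%:R * (x 0 w - x 0 v).
Proof.
under eq_bigr do rewrite mulrBr; rewrite sumrB -mulr_suml sum_adj.
rewrite mulmxBr mxE mul_mx_diag !mxE mulrC; congr (_ - _).
by apply: eq_bigr => v _; rewrite mxE mulrC adj_sym.
Qed.

Lemma trmx_lap (R : rcfType) (n : nat) (X : sgraph n) : (lap R X)^T = lap R X.
Proof.
rewrite linearB /= tr_diag_mx; congr (_ - _).
by apply/matrixP => u v; rewrite !mxE adj_sym.
Qed.

Lemma sum_lap_act (R : rcfType) (n : nat) (X : sgraph n) (x : 'rV[R]_n) :
  \sum_w (x *m lap R X) 0 w = 0.
Proof.
under eq_bigr do rewrite lap_act.
under eq_bigr do (under eq_bigr do rewrite mulrBr; rewrite sumrB).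
rewrite sumrB [X in _ - X]exchange_big /=; apply/eqP; rewrite subr_eq0.
by apply/eqP/eq_bigr => u _; apply: eq_bigr => v _; rewrite adj_sym.
Qed.

Lemma lap_eigen_sum0 (R : rcfType) (n : nat) (X : sgraph n) (x : 'rV[R]_n) (l : R) :
  l != 0 -> x *m lap R X = l *: x -> \sum_w x 0 w = 0.
Proof.
move=> l0 xl; apply: (mulfI l0); rewrite mulr_sumr mulr0 -[RHS](sum_lap_act X x).
by apply: eq_bigr => w _; rewrite xl mxE.
Qed.

(** If [L] kills [x] then so does the quadratic form of [L], which is the sum
    over the edges of the squared differences of the values of [x]. *)
Lemma lap_ker_adj (R : rcfType) (n : nat) (X : sgraph n) (x : 'rV[R]_n) :
  x *m lap R X = 0 -> forall u v, adj X u v -> x 0 u = x 0 v.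
Proof.
move=> x0; pose F u v := (adj X u v)%:R * (x 0 u - x 0 v) ^+ 2.
have F_ge0 u v : 0 <= F u v by rewrite mulr_ge0 ?ler0n ?sqr_ge0.
(* [E] is the quadratic form [x L x^T]; exchanging the two ends of the edges
   in one copy of it shows that the sum of [F] is twice [E]. *)
set E := \sum_u \sum_v x 0 u * ((adj X u v)%:R * (x 0 u - x 0 v)).
have E0 : E = 0.
  by apply: big1 => u _; rewrite -mulr_sumr -lap_act x0 mxE mulr0.
have F0 : \sum_u \sum_v F u v = 0.
  transitivity (E + E); last by rewrite E0 addr0.
  rewrite {2}/E [X in _ + X]exchange_big -big_split; apply: eq_bigr => u _ /=.
  rewrite -big_split; apply: eq_bigr => v _ /=.
  by rewrite /F (adj_sym X v u); ring.
move=> u v uv.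
have Fu0 : \sum_v F u v = 0.
  by apply: (psumr_eq0P _ F0) => // w _; apply: sumr_ge0.
have /eqP : F u v = 0 by apply: (psumr_eq0P _ Fu0).
by rewrite /F uv mul1r sqrf_eq0 subr_eq0 => /eqP.
Qed.

Lemma lap_ker_connect (R : rcfType) (n : nat) (X : sgraph n) (x : 'rV[R]_n)
    (u v : 'I_n) :
  x *m lap R X = 0 -> connect (adj X) u v -> x 0 u = x 0 v.
Proof.
move=> /lap_ker_adj x0 /connectP[p pathp ->].
by elim: p u pathp => //= w p IHp u /andP[/x0-> /IHp].
Qed.

(** * The Laplacian of the complement *)

Lemma deg_compl (n : nat) (X : sgraph n) (u : 'I_n) :
  (deg X u + deg (gcompl X) u).+1 = n.
Proof.
have -> : deg (gcompl X) u = #|[set~ u] :\: [set v | adj X u v]|.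
  by apply: eq_card => v; rewrite !inE /= /compl_adj andbC eq_sym.
rewrite cardsD /deg.
have -> : [set~ u] :&: [set v | adj X u v] = [set v | adj X u v].
  apply/setP => v; rewrite !inE; case: eqP => //= ->.
  by rewrite adj_irr.
rewrite subnKC.
  by rewrite cardsC1 card_ord prednK // (leq_ltn_trans _ (ltn_ord u)).
apply/subset_leq_card/subsetP => v; rewrite !inE.
by apply: contraTneq => ->; rewrite adj_irr.
Qed.

Lemma lap_compl (R : rcfType) (n : nat) (X : sgraph n) :
  lap R (gcompl X) = n%:R%:M - const_mx 1 - lap R X.
Proof.
apply/matrixP => u v; rewrite !mxE /= /compl_adj.
have [->|_] := eqVneq u v.
  rewrite adj_irr !mulr1n -[X in X%:R - 1](deg_compl X v).
  by rewrite -addn1 !natrD /=; ring.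
by rewrite !mulr0n /=; case: (adj X u v) => /=; ring.
Qed.

Lemma lap_complK (R : rcfType) (n : nat) (X : sgraph n) :
  lap R (gcompl (gcompl X)) = lap R X.
Proof. by rewrite !lap_compl subKr. Qed.

(** The matrix [J] kills the vectors whose entries sum to zero, so on them
    [L'] acts as [n - L]. *)
Lemma lap_eigen_compl (R : rcfType) (n : nat) (X : sgraph n) (x : 'rV[R]_n) (l : R) :
  \sum_w x 0 w = 0 -> x *m lap R X = l *: x ->
  x *m lap R (gcompl X) = (n%:R - l) *: x.
Proof.
move=> sum0 xl; rewrite lap_compl 2!mulmxBr mul_mx_scalar xl scalerBl.
suff -> : x *m (const_mx 1 : 'M_n) = 0 by rewrite subr0.
apply/rowP => j; rewrite !mxE -[RHS]sum0.
by apply: eq_bigr => w _; rewrite mxE mulr1.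
Qed.

(** Away from the kernel of [L'], the eigenspaces of [L'] are contained in
    eigenspaces of [L], and inherit their sign. *)
Lemma strongly_cospectral_lap_compl (R : rcfType) (n : nat) (X : sgraph n)
    (u v : 'I_n) :
  (forall x : 'rV[R]_n, x *m lap R (gcompl X) = 0 -> x 0 u = x 0 v) ->
  strongly_cospectral (lap R X) u v -> strongly_cospectral (lap R (gcompl X)) u v.
Proof.
move=> ker_uv /strongly_cospectralP sc; apply/strongly_cospectralP => l.
have [->|l0] := eqVneq l 0.
  by left=> x; rewrite scale0r; exact: ker_uv.
have to_X (x : 'rV[R]_n) : x *m lap R (gcompl X) = l *: x ->
    x *m lap R X = (n%:R - l) *: x.
  move=> xl; rewrite -lap_complK.
  exact: lap_eigen_compl (lap_eigen_sum0 l0 xl) xl.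
by case: (sc (n%:R - l)) => H; [left|right] => x /to_X/H.
Qed.

(** * Components of the complement *)

Definition restrict (R : rcfType) (n : nat) (C : pred 'I_n) (x : 'rV[R]_n) :
    'rV[R]_n :=
  \row_w ((C w)%:R * x 0 w).

(** Restriction to a union of components commutes with the Laplacian. *)
Lemma lap_eigen_restrict (R : rcfType) (n : nat) (X : sgraph n) (C : pred 'I_n)
    (x : 'rV[R]_n) (l : R) :
  (forall a b, adj X a b -> C a = C b) ->
  x *m lap R X = l *: x -> restrict C x *m lap R X = l *: restrict C x.
Proof.
move=> closedC xl; apply/rowP => w; rewrite lap_act !mxE.
transitivity ((C w)%:R * (x *m lap R X) 0 w); last by rewrite xl mxE mulrCA.
rewrite lap_act mulr_sumr; apply: eq_bigr => v _; rewrite !mxE.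
have [wv|_] := boolP (adj X w v); last by rewrite !mul0r mulr0.
by rewrite (closedC _ _ wv) -mulrBr mulrCA.
Qed.

Lemma connect_adj_r (n : nat) (X : sgraph n) (u a b : 'I_n) :
  adj X a b -> connect (adj X) u a = connect (adj X) u b.
Proof.
move=> ab; apply: same_connect_r (connect1 ab) _.
exact/sym_connect_sym/adj_sym.
Qed.

(** Decompose [charvec u] into eigenvectors of [L'] and restrict them to the
    component [C] of [u]. Each piece satisfies
    [sum of the entries = #|C| * value at u]: in the kernel of [L'] because the
    piece is constant on [C], elsewhere because both sides are zero, the right
    one by strong cospectrality. Adding up gives [1 = #|C|]. *)
Lemma compl_component_card (R : rcfType) (n : nat) (X : sgraph n) (u v : 'I_n) :
  strongly_cospectral (lap R X) u v -> ~~ connect (adj (gcompl X)) u v ->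
  #|connect (adj (gcompl X)) u| = 1%N.
Proof.
move=> /strongly_cospectralP sc; set C := connect _ u => nCv.
have closedC a b : adj (gcompl X) a b -> C a = C b := @connect_adj_r _ _ u a b.
have [lam [x [xl eu]]] := symmetric_eigen_sum (trmx_lap R (gcompl X)) (charvec u).
pose y i := restrict C (x i).
have yl i : y i *m lap R (gcompl X) = lam i *: y i.
  exact: lap_eigen_restrict (xl i).
have sum_y i : \sum_w y i 0 w = #|C|%:R * y i 0 u.
  have [l0|l0] := eqVneq (lam i) 0.
    have yu w : y i 0 w = (C w)%:R * y i 0 u.
      have [Cw|nCw] := boolP (C w); last by rewrite mxE (negbTE nCw) !mul0r.
      by rewrite mul1r; apply/esym/(lap_ker_connect _ Cw); rewrite yl l0 scale0r.
    under eq_bigr do rewrite yu.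
    by rewrite -mulr_suml -natr_sum -big_mkcond sum1_card.
  (* Here [y i] is also an eigenvector of [L], and it vanishes at [v]. *)
  have sum0 := lap_eigen_sum0 l0 (yl i).
  rewrite sum0; have := lap_eigen_compl sum0 (yl i); rewrite lap_complK => yX.
  have yv0 : y i 0 v = 0 by rewrite mxE (negbTE nCv) mul0r.
  case: (sc (n%:R - lam i)) => /(_ _ yX); rewrite yv0 ?oppr0 => ->;
    by rewrite mulr0.
have eC w : \sum_i y i 0 w = (w == u)%:R.
  transitivity ((C w)%:R * charvec (R := R) u 0 w).
    by rewrite eu summxE mulr_sumr; apply: eq_bigr => i _; rewrite mxE.
  rewrite mxE eqxx /=; have [->|_] := eqVneq w u; last by rewrite mulr0.
  by rewrite /C connect0 mul1r.
apply/eqP; rewrite -(@eqr_nat R) -[X in X == _]mulr1; apply/eqP.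
transitivity (#|C|%:R * \sum_i y i 0 u); first by rewrite eC eqxx.
rewrite mulr_sumr; under eq_bigr do rewrite -sum_y.
rewrite exchange_big /= (bigD1 u) //= eC eqxx big1 ?addr0 // => w /negbTE wu.
by rewrite eC wu.
Qed.

(** Otherwise the component [C] of [u] is a singleton, and [n 1_C - 1] is an
    eigenvector of [L] for the eigenvalue [n] whose values [n - 1] at [u] and
    [-1] at [v] have distinct absolute values. *)
Lemma strongly_cospectral_lap_connect_compl (R : rcfType) (n : nat) (X : sgraph n)
    (u v : 'I_n) :
  n != 2%N -> strongly_cospectral (lap R X) u v -> connect (adj (gcompl X)) u v.
Proof.
move=> n2 sc; apply: contraNT n2 => nCv.
have C1 := compl_component_card sc nCv; set C := connect _ u in nCv C1.
have closedC a b : adj (gcompl X) a b -> C a = C b := @connect_adj_r _ _ u a b.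
have ker1 : (const_mx 1 : 'rV[R]_n) *m lap R (gcompl X) = 0 *: const_mx 1.
  apply/rowP => w; rewrite lap_act !mxE mul0r; apply: big1 => a _.
  by rewrite !mxE subrr mulr0.
pose y : 'rV[R]_n := n%:R *: restrict C (const_mx 1) - const_mx 1.
have yE w : y 0 w = n%:R * (C w)%:R - 1 by rewrite !mxE mulr1.
have y0 : y *m lap R (gcompl X) = 0 *: y.
  rewrite mulmxBl ker1 -scalemxAl (lap_eigen_restrict closedC ker1).
  by rewrite !scale0r scaler0 subrr.
have sumy : \sum_w y 0 w = 0.
  under eq_bigr do rewrite yE.
  rewrite sumrB -mulr_sumr -natr_sum -big_mkcond sum1_card C1 mulr1.
  by rewrite sumr_const card_ord subrr.
have := lap_eigen_compl sumy y0; rewrite lap_complK => yX.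
move/strongly_cospectralP: sc => /(_ (n%:R - 0)).
have Cu : C u by exact: connect0.
case=> /(_ y yX)/eqP; rewrite !yE Cu (negbTE nCv) mulr1 mulr0.
  rewrite (inj_eq (addIr _)) pnatr_eq0 => /eqP n0.
  by have := leq_ltn_trans (leq0n u) (ltn_ord u); rewrite n0.
by rewrite sub0r opprK subr_eq -[1 + 1]/2%:R eqr_nat.
Qed.

Lemma strongly_cospectral_lap_complE (R : rcfType) (n : nat) (X : sgraph n)
    (u v : 'I_n) :
  gconnected X -> n != 2%N ->
  strongly_cospectral (lap R X) u v <->
  strongly_cospectral (lap R (gcompl X)) u v.
Proof.
move=> Xconn n2; split=> sc.
  apply: strongly_cospectral_lap_compl (sc) => x x0.
  exact/(lap_ker_connect x0)/(strongly_cospectral_lap_connect_compl n2 sc).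
rewrite -lap_complK; apply: strongly_cospectral_lap_compl sc => x.
by rewrite lap_complK => x0; exact/(lap_ker_connect x0)/Xconn.
Qed.

(** * Reduction to Laplacians *)

Lemma regular_gcompl (n : nat) (X : sgraph n) : regular X -> regular (gcompl X).
Proof.
move=> [k degk]; exists (n.-1 - k)%N => u.
have := deg_compl X u; rewrite degk => /(congr1 predn) /= <-.
by rewrite addKn.
Qed.

Lemma degmx_regular (R : rcfType) (n : nat) (X : sgraph n) (k : nat) :
  (forall u, deg X u = k) -> degmx X = (k%:R)%:M :> 'M[R]_n.
Proof.
by move=> degk; apply/matrixP => u v; rewrite !mxE degk.
Qed.

Lemma gen_adjmx_regular (R : rcfType) (n : nat) (X : sgraph n)
    (alpha beta gamma : R) :
  regular X ->
  exists a, gen_adjmx alpha beta gamma X = a%:M + (- gamma) *: lap R X.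
Proof.
move=> [k /(degmx_regular R) Dk]; exists (alpha + (beta + gamma) * k%:R).
rewrite /gen_adjmx /lap Dk.
by apply/matrixP => u v; rewrite !mxE; case: (u == v); rewrite ?mulr1n ?mulr0n; ring.
Qed.

Lemma gen_norm_adjmx_regular (R : rcfType) (n : nat) (X : sgraph n)
    (alpha gamma : R) (u : 'I_n) :
  regular X -> degs_pos X -> gamma != 0 ->
  exists a c, c != 0 /\ gen_norm_adjmx alpha gamma X = a%:M + c *: lap R X.
Proof.
move=> [k degk] /(_ u); rewrite degk => k_gt0 g0.
have k0 : k%:R != 0 :> R by rewrite pnatr_eq0 -lt0n.
exists (alpha + gamma), (- (gamma / k%:R)); split.
  by rewrite oppr_eq0 mulf_neq0 ?invr_eq0.
have Dk : degmx_isqrt X = ((Num.sqrt k%:R)^-1)%:M :> 'M[R]_n.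
  by apply/matrixP => a b; rewrite !mxE degk.
rewrite /gen_norm_adjmx Dk /lap (degmx_regular R degk).
rewrite mul_scalar_mx mul_mx_scalar !scalerA.
rewrite -mulrA -invfM -expr2 sqr_sqrtr ?ler0n //.
by apply/matrixP => a b; rewrite !mxE; case: (a == b); rewrite ?mulr1n ?mulr0n; field.
Qed.

Theorem theorem3p6 (R : realType) (n : nat) (alpha beta gamma : R)
    (gamma_neq0 : gamma != 0) (X : sgraph n) (X_connected : gconnected X)
    (X_not_K2 : n != 2%N) :
  (regular X ->
    (forall u v : 'I_n,
       strongly_cospectral (gen_adjmx alpha beta gamma X) u v <->
       strongly_cospectral (gen_adjmx alpha beta gamma (gcompl X)) u v) /\
    (degs_pos X -> degs_pos (gcompl X) ->
     forall u v : 'I_n,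
       strongly_cospectral (gen_norm_adjmx alpha gamma X) u v <->
       strongly_cospectral (gen_norm_adjmx alpha gamma (gcompl X)) u v)) /\
  (beta = - gamma ->
    forall u v : 'I_n,
      strongly_cospectral (gen_adjmx alpha beta gamma X) u v <->
      strongly_cospectral (gen_adjmx alpha beta gamma (gcompl X)) u v).
Proof.
have lapE u v := strongly_cospectral_lap_complE R u v X_connected X_not_K2.
have Ngamma_neq0 : - gamma != 0 by rewrite oppr_eq0.
split=> [Xreg|beta_gamma u v]; last first.
  have gapE Y : gen_adjmx alpha beta gamma Y = alpha%:M + (- gamma) *: lap R Y.
    by rewrite /gen_adjmx beta_gamma scalerBr -addrA !scaleNr opprK.
  by rewrite !gapE !strongly_cospectral_affine.
have Xcreg := regular_gcompl Xreg; split=> [u v|Xpos Xcpos u v].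
  have [a ->] := gen_adjmx_regular alpha beta gamma Xreg.
  have [b ->] := gen_adjmx_regular alpha beta gamma Xcreg.
  by rewrite !strongly_cospectral_affine.
have [a [c [c0 ->]]] := gen_norm_adjmx_regular alpha u Xreg Xpos gamma_neq0.
have [b [d [d0 ->]]] := gen_norm_adjmx_regular alpha u Xcreg Xcpos gamma_neq0.
by rewrite !strongly_cospectral_affine.
Qed.
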